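(* Let the plasma and projectile satisfy all the standing conditions (A)–(E) listed in the context, and let the stopping power of a projectile of speed $v$ be $$-\frac{dE}{dx}(v)=\frac{2(Z_pe)^2}{\pi v^2}\int_0^\infty\frac{dk}{k}\int_{\alpha_-(k)}^{\alpha_+(k)}\omega\, n_B(\omega)\,\big(-\operatorname{Im}\epsilon^{-1}(k,\omega)\big)\,d\omega,\qquad \alpha_\pm(k)=\pm kv+\frac{\hbar k^2}{2M}.$$ Then, asymptotically as $v/v_F\to\infty$ (all plasma parameters, $M$ and $Z_p$ being fixed), $$\Big(\frac{v_F}{v}\Big)^2\lesssim\Big(\frac{v_F}{Z_pe\,\omega_p}\Big)^2\Big(-\frac{dE}{dx}(v)\Big)\lesssim\Big(\frac{v_F}{v}\Big)^2\ln\frac{v}{v_F},$$ where $\lesssim$ means inequality for all sufficiently large $v$ up to a positive constant factor independent of $v$.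
   Context: Constants: $Z_p,e,m,M,n,\hbar,\beta,v_F,k_F>0$ are fixed (projectile charge number, elementary charge, electron mass, projectile mass with $M\gg m$, electron density, reduced Planck constant, inverse temperature in energy units, electron Fermi velocity and Fermi wavenumber). $\omega_p=(4\pi ne^2/m)^{1/2}$ and $n_B(\omega)=(1-e^{-\beta\hbar\omega})^{-1}$. The system is a completely ionized electron-ion (hydrogen) plasma in the liquid phase, unmagnetized, so that its inverse dielectric function $\epsilon^{-1}(k,\omega)$ depends only on the wavevector modulus $k>0$ and on $\omega\in\mathbb R$. The loss function is $\mathcal L(k,\omega)=-\omega^{-1}\operatorname{Im}\epsilon^{-1}(k,\omega)$, so that the integrand above equals $\omega^2n_B(\omega)\mathcal L(k,\omega)$. Standing conditions. (A) Loss function and sum rules. $\mathcal L\ge0$, $\mathcal L(k,\cdot)$ is even, and the moments $C_\nu(k)=\pi^{-1}\int_{-\infty}^\infty\omega^\nu\mathcal L(k,\omega)\,d\omega$, $\nu=0,2,4$, are finite with $C_0(k)=1-\epsilon^{-1}(k,0)$, $C_2(k)=\omega_p^2$, and $C_4(k)=\omega_p^4\,(1+K(k)+U(k)+H)$. Here $K(k)=\big(\langle v_e^2\rangle k^2+\hbar^2k^4/(2m)^2\big)/\omega_p^2$ with $\langle v_e^2\rangle$ the average squared characteristic velocity of the plasma electrons; $H=(6\pi^2n)^{-1}\int_0^\infty p^2S_{ei}(p)\,dp$ is a constant with $1+H>0$; and $U(k)=(2\pi^2n)^{-1}\int_0^\infty p^2(S_{ee}(p)-1)f(p,k)\,dp$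 with $f(p,k)=\frac5{12}-\frac{p^2}{4k^2}+\frac{(k^2-p^2)^2}{8pk^3}\ln\left|\frac{p+k}{p-k}\right|$, where $S_{ee},S_{ei}$ are the electron-electron and electron-ion partial static structure factors. One has $U(k)\simeq-v_{ee}^2k^2/\omega_p^2$ as $k\to0$, and $U(k)\simeq-h_{ee}(0)/3$ as $k\to\infty$, where $v_{ee}^2$ and $h_{ee}(0)$ are constants. (B) Collective mode. Put $\omega_2(k)^2=C_4(k)/C_2(k)$. For large $v$ there are cut-offs $k_1'=k_1'(v)<k_2=k_2(v)$, with $k_1'\sim\omega_p\sqrt{1+H}/v$ and $k_2\sim2mv/\hbar$ as $v/v_F\to\infty$, such that $\omega_2(k)<kv$ for all $k\in(k_1',k_2)$. (C) Fluctuation-dissipation theorem. The dynamic structure factor $S(k,\omega)\ge0$ satisfies $$n_B(\omega)\,\big(-\operatorname{Im}\epsilon^{-1}(k,\omega)\big)=\frac{4\pi^2e^2}{\hbar k^2}S(k,\omega),$$ and $S(k)=n^{-1}\int_{-\infty}^\infty S(k,\omega)\,d\omega$ denotes the charge-charge static structure factor. (D) Perfect screening, in the form of the resulting bound $\displaystyle\lim_{k\to0}\frac{S(k)}{k^2}\le\frac{\hbar\omega_p\coth(\hbar\omega_p\beta/2)}{8\pi ne^2}$. (E) Hölder-type decay condition. Let $\Sigma(k,\cdot)$ be a distribution function of the measure $d\Sigma=\mathcal L(k,\omega)\,d\omega$, so that $\Sigma(k,b)-\Sigma(k,a)=\int_a^b\mathcal L(k,\omega)\,d\omega$. There are constants $0<\nu\le1$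 and $\mu\ge3$ such that, for all sufficiently large $v$ and all $k\ge k_2''(v):=k_F\,v^2/v_F^2$ (for large $v$ this is much larger than $2Mv/\hbar$), $$\big|\Sigma(k,\alpha_+(k))-\Sigma(k,\alpha_-(k))\big|\le\Big(\frac{\omega_p}{\alpha_+(k)}\Big)^{\mu}\left|\frac{\alpha_+(k)-\alpha_-(k)}{\omega_p}\right|^{\nu}.$$
   Formalization: The proved theorem additionally assumes that C_0(k)=1-ε^{-1}(k,0) stays bounded above as k→∞; without this, (A)–(E) allow loss spectra concentrated near ω=0 at k≈2Mv/ħ, for which the stopping power is infinite along a sequence v→∞. *)

(* Defs.v *)
From mathcomp Require Import all_boot all_order all_algebra.
From mathcomp Require Import complex.
From mathcomp Require Import all_classical all_reals all_analysis.

Set Implicit Arguments.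
Unset Strict Implicit.
Unset Printing Implicit Defensive.

Import Order.TTheory GRing.Theory Num.Theory.
Import numFieldNormedType.Exports.

Local Open Scope classical_set_scope.
Local Open Scope ring_scope.

(* Gaussian units; only arguments k > 0 of the functions are meaningful. *)
Record plasma_projectile (R : realType) := PlasmaProjectile {
  charge_number : R;      (* Z_p *)
  elementary_charge : R;  (* e *)
  electron_mass : R;      (* m *)
  projectile_mass : R;    (* M *)
  electron_density : R;   (* n *)
  reduced_planck : R;     (* hbar *)
  inverse_temperature : R;(* beta, in inverse energy units *)
  fermi_velocity : R;     (* v_F *)
  fermi_wavenumber : R;   (* k_F *)
  (* k, omega |-> epsilon^-1(k, omega), k the wavevector modulus *)
  inv_dielectric : R -> R -> R[i];
  mean_sq_velocity : R;   (* <v_e^2> *)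
  dyn_structure : R -> R -> R; (* S(k, omega) *)
  structure_ee : R -> R;  (* S_ee *)
  structure_ei : R -> R   (* S_ei *)
}.

Section PlasmaProjectile.
Context {R : realType} (P : plasma_projectile R).

Local Notation Zp := (charge_number P).
Local Notation e := (elementary_charge P).
Local Notation m := (electron_mass P).
Local Notation M := (projectile_mass P).
Local Notation n := (electron_density P).
Local Notation hbar := (reduced_planck P).
Local Notation beta := (inverse_temperature P).
Local Notation vF := (fermi_velocity P).
Local Notation kF := (fermi_wavenumber P).
Local Notation epsinv := (inv_dielectric P).
Local Notation ve2 := (mean_sq_velocity P).
Local Notation Sdyn := (dyn_structure P).
Local Notation See := (structure_ee P).
Local Notation Sei := (structure_ei P).
Local Notation leb := (@lebesgue_measure R).

(* M >> m is weakened to m < M; no relation is imposed between vF, kF, m and n. *)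
Definition admissible_constants : Prop :=
  [/\ [/\ 0 < Zp, 0 < e, 0 < m & m < M],
      [/\ 0 < n, 0 < hbar & 0 < beta],
      [/\ 0 < vF & 0 < kF] &
      0 <= ve2].

Definition plasma_freq : R := Num.sqrt (4 * pi * n * e ^+ 2 / m).
Local Notation omega_p := plasma_freq.

(* At omega = 0, the pole of nB, the value is 0 since 0^-1 = 0; likewise for
   loss k 0.  This affects no integral. *)
Definition nB (omega : R) : R := (1 - expR (- (beta * hbar * omega)))^-1.

Definition loss (k omega : R) : R := - (omega^-1 * complex.Im (epsinv k omega)).

Definition moment (nu : nat) (k : R) : R :=
  pi^-1 * \int[leb]_(omega in [set: R]) (omega ^+ nu * loss k omega).

Definition kinetic_term (k : R) : R :=
  (ve2 * k ^+ 2 + hbar ^+ 2 * k ^+ 4 / (2 * m) ^+ 2) / omega_p ^+ 2.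

Definition hydrogen_const : R :=
  (6 * pi ^+ 2 * n)^-1 * \int[leb]_(p in `]0, +oo[) (p ^+ 2 * Sei p).

Definition ee_kernel (p k : R) : R :=
  5 / 12 - p ^+ 2 / (4 * k ^+ 2)
  + (k ^+ 2 - p ^+ 2) ^+ 2 / (8 * p * k ^+ 3) * ln `|(p + k) / (p - k)|.

Definition ee_term (k : R) : R :=
  (2 * pi ^+ 2 * n)^-1
  * \int[leb]_(p in `]0, +oo[) (p ^+ 2 * (See p - 1) * ee_kernel p k).

Definition sum_rules : Prop :=
  [/\ (forall k omega, 0 < k -> 0 <= loss k omega),
      (forall k omega, 0 < k -> loss k (- omega) = loss k omega),
      (forall k nu, 0 < k -> nu \in [:: 0%N; 2%N; 4%N] ->
         leb.-integrable [set: R]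
           (fun omega => (omega ^+ nu * loss k omega)%:E)) &
      forall k, 0 < k ->
        [/\ ((moment 0 k)%:C)%C = 1 - epsinv k 0,
            moment 2 k = omega_p ^+ 2 &
            moment 4 k = omega_p ^+ 4
              * (1 + kinetic_term k + ee_term k + hydrogen_const)]].

Definition correlation_terms : Prop :=
  [/\ leb.-integrable `]0, +oo[ (fun p => (p ^+ 2 * Sei p)%:E),
      0 < 1 + hydrogen_const,
      (forall k, 0 < k -> leb.-integrable `]0, +oo[
         (fun p => (p ^+ 2 * (See p - 1) * ee_kernel p k)%:E)),
      (exists vee2 : R,
         ee_term k / k ^+ 2 @[k --> 0^'+] --> - vee2 / omega_p ^+ 2) &
      (exists hee0 : R, ee_term k @[k --> +oo] --> - hee0 / 3)].

Definition omega2 (k : R) : R := Num.sqrt (moment 4 k / moment 2 k).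

Definition collective_mode : Prop :=
  exists k1 k2 : R -> R,
    [/\ (k1 v / (omega_p * Num.sqrt (1 + hydrogen_const) / v))
          @[v --> +oo] --> (1 : R),
        (k2 v / (2 * m * v / hbar)) @[v --> +oo] --> (1 : R) &
        \forall v \near +oo, k1 v < k2 v /\
          forall k, k1 v < k < k2 v -> omega2 k < k * v].

Definition fluctuation_dissipation : Prop :=
  forall k omega, 0 < k ->
    0 <= Sdyn k omega /\
    (omega != 0 -> nB omega * - complex.Im (epsinv k omega)
       = 4 * pi ^+ 2 * e ^+ 2 / (hbar * k ^+ 2) * Sdyn k omega).

Definition static_structure (k : R) : R :=
  n^-1 * \int[leb]_(omega in [set: R]) Sdyn k omega.

Definition coth (x : R) : R :=
  (expR x + expR (- x)) / (expR x - expR (- x)).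

Definition perfect_screening : Prop :=
  exists2 s : R, static_structure k / k ^+ 2 @[k --> 0^'+] --> s
    & s <= hbar * omega_p * coth (hbar * omega_p * beta / 2)
           / (8 * pi * n * e ^+ 2).

Definition alpha_p (v k : R) : R := k * v + hbar * k ^+ 2 / (2 * M).
Definition alpha_m (v k : R) : R := - (k * v) + hbar * k ^+ 2 / (2 * M).

(* Sigma k is determined up to an additive constant depending on k. *)
Definition distribution_function (Sigma : R -> R -> R) : Prop :=
  forall k a b, 0 < k -> a <= b ->
    Sigma k b - Sigma k a = \int[leb]_(omega in `[a, b]) loss k omega.

Definition holder_decay : Prop :=
  exists2 Sigma : R -> R -> R, distribution_function Sigma &
  exists nu mu : R, [/\ 0 < nu <= 1, 3 <= mu &
    \forall v \near +oo, forall k, kF * v ^+ 2 / vF ^+ 2 <= k ->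
      `|Sigma k (alpha_p v k) - Sigma k (alpha_m v k)|
      <= (omega_p / alpha_p v k) `^ mu
         * `|(alpha_p v k - alpha_m v k) / omega_p| `^ nu].

(* moment 0 k = 1 - epsinv k 0 tends to 0 as k --> +oo in an actual plasma.  A
   bound at large k is needed because alpha_m v k vanishes at k = 2Mv / hbar,
   where omega * nB omega does not vanish at omega = 0: the moments 2 and 4
   alone do not control the integral over k there. *)
Definition bounded_static_response : Prop :=
  exists B : R, \forall k \near +oo, moment 0 k <= B.

(* The inner integral is nonnegative for k, v > 0 (the integrand is negative only
   for omega < 0, and |alpha_m| <= alpha_p), so the outer one is
   always defined, possibly +oo. *)
Definition stopping_power (v : R) : \bar R :=
  ((2 * (Zp * e) ^+ 2 / (pi * v ^+ 2))%:E *
   \int[leb]_(k in `]0%R, +oo[)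
     (k^-1 * \int[leb]_(omega in `[alpha_m v k, alpha_p v k])
        (omega * nB omega * - complex.Im (epsinv k omega))%R)%:E)%E.

End PlasmaProjectile.

(* f <~ g as v --> +oo *)
Definition asym_le {R : realType} (f g : R -> \bar R) : Prop :=
  exists2 C : R, 0 < C & \forall v \near +oo, (f v <= C%:E * g v)%E.

(* Main.v *)
(** Write I(v, k) for the inner integral.  Since nB(w) + nB(-w) = 1 and the loss
    function L is even, reflecting w gives I = 1/2 int W L, where, when
    alpha_m < 0, the folded weight W(w) is w^2 for |w| <= |alpha_m| and
    w^2 nB(|w|) on the rest of the window.  Put c = 1 / (beta hbar); then
    nB(w) <= 1 + c / w for w > 0.
    Lower bound: W(w) >= w^2 - w^4 / alpha_m^2, so I >= pi/2 (C_2 - C_4 / alpha_m^2),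
    which stays away from 0 for k in a fixed interval [K, 2K] on which C_4 is
    bounded, because alpha_m ~ - k v there.
    Upper bound of int I dk / k, over three ranges of k:
    - k < 2c/v: I <= alpha_p int w nB L, and the last integral is a multiple of
      S(k) / k^2, bounded by perfect screening; so I / k = O(v).
    - 2c/v <= k <= k_F v^2 / v_F^2: I is bounded, by pi C_2 as long as
      alpha_m <= - c, and by C_0 and C_2 near the zero of alpha_m, where k is
      large.  This range produces the logarithm.
    - beyond: the decay condition gives I = O(v / k). *)
Require Import Defs.
From mathcomp Require Import all_boot all_order all_algebra.
From mathcomp Require Import all_classical all_reals all_analysis.
From mathcomp Require Import measurable_realfun ring lra.

Set Implicit Arguments.
Unset Strict Implicit.
Unset Printing Implicit Defensive.

Import Order.TTheory GRing.Theory Num.Theory.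
Import numFieldNormedType.Exports.

Local Open Scope classical_set_scope.
Local Open Scope ring_scope.

(* No measurability is required: the integral of a nonnegative function is the
   supremum over the simple functions below it.  This matters because nothing
   makes the outer integrand measurable in k. *)
Lemma ge0_le_integral_lower d (T : measurableType d) (R : realType)
    (mu : {measure set T -> \bar R}) (D : set T) (f g : T -> \bar R) :
  (forall x, D x -> 0 <= f x)%E -> (forall x, D x -> f x <= g x)%E ->
  (\int[mu]_(x in D) f x <= \int[mu]_(x in D) g x)%E.
Proof.
move=> f0 fg.
have g0 x : D x -> (0 <= g x)%E by move=> Dx; exact: le_trans (f0 x Dx) (fg x Dx).
rewrite !ge0_integralE//; apply: ge_ereal_sup => _ [h /= hf <-].
apply: ereal_sup_ubound; exists h => //= x.
exact: le_trans (hf x) (lee_restrict fg x).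
Qed.

(** * Invariance of Lebesgue integrals under w -> -w *)

Section reflection.
Context {R : realType}.
Local Notation mu := (@lebesgue_measure R).

(** Gives negation the codomain type that the pushforward measures below are written with. *)
Lemma measurable_oppr_measurableTypeR :
  measurable_fun [set: R] (-%R : R -> measurableTypeR R).
Proof. exact: oppr_measurable. Qed.

Lemma ge0_integral_oppr (f : R -> \bar R) :
  measurable_fun [set: R] f -> (forall x, 0 <= f x)%E ->
  (\int[mu]_x f (- x)%R = \int[mu]_x f x)%E.
Proof.
move=> mf f0.
transitivity (\int[pushforward mu (-%R : R -> measurableTypeR R)]_x f x)%E.
  by rewrite ge0_integral_pushforward//; exact: measurable_oppr_measurableTypeR.
by apply: eq_measure_integral => A mA _; exact: lebesgue_measureN.
Qed.

Lemma integrable_oppr (f : R -> R) :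
  mu.-integrable setT (EFin \o f) -> mu.-integrable setT (fun x => (f (- x))%:E).
Proof.
move=> /integrableP[mf foo]; apply/integrableP; split.
  exact: (measurableT_comp mf measurable_oppr_measurableTypeR).
rewrite (ge0_integral_oppr (f := fun x => `|(f x)%:E|%E))//.
exact: measurableT_comp.
Qed.

Lemma Rintegral_oppr (f : R -> R) : mu.-integrable setT (EFin \o f) ->
  \int[mu]_x f (- x) = \int[mu]_x f x.
Proof.
move=> fi; congr fine.
transitivity (\int[pushforward mu (-%R : R -> measurableTypeR R)]_x (f x)%:E)%E.
  rewrite integral_pushforward//.
  - exact: measurable_int fi.
  - exact: integrable_oppr.
by apply: eq_measure_integral => A mA _; exact: lebesgue_measureN.
Qed.

End reflection.

(** Inversion is continuous on the open set of nonzero reals; the point 0 is split off. *)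
Lemma measurable_invr {R : realType} : measurable_fun [set: R] (GRing.inv : R -> R).
Proof.
have -> : [set: R] = [set x | x != 0] `|` [set 0].
  by apply/seteqP; split=> x //= _; have [->|x0] := eqVneq x 0; [right|left].
have m0 : measurable [set x : R | x != 0].
  rewrite (_ : mkset _ = ~` [set 0]); first exact: measurableC.
  by apply/seteqP; split=> x /=; [move/eqP|move=> /eqP].
apply/measurable_funU => //; split; last exact: measurable_fun_set1.
apply: open_continuous_measurable_fun => [|x]; first exact: open_neq.
by rewrite inE /= => x0; exact: inv_continuous.
Qed.

(** * Identities and bounds for the Bose factor *)

Section bose_factor.
Context {R : realType} (P : plasma_projectile R).
Local Notation b := (inverse_temperature P * reduced_planck P).
Hypothesis b0 : 0 < b.

Lemma nB_add_nBN (w : R) : w != 0 -> nB P w + nB P (- w) = 1.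
Proof.
move=> w0; rewrite /nB mulrN opprK.
set x := b * w; have x0 : x != 0 by rewrite mulf_neq0// gt_eqF.
have e0 : 0 < expR x by exact: expR_gt0.
have e1 : expR x != 1 by rewrite -expR0; apply: contra x0 => /eqP/expR_inj->.
have e1' : expR x - 1 != 0 by rewrite subr_eq0.
rewrite expRN; field.
by apply/and3P; split; rewrite ?(gt_eqF e0)// subr_eq0 eq_sym.
Qed.

Lemma nB_ge1 (w : R) : 0 < w -> 1 <= nB P w.
Proof.
move=> w0; rewrite /nB invf_ge1.
  by rewrite gerBl expR_ge0.
by rewrite subr_gt0 expR_lt1 oppr_lt0 mulr_gt0.
Qed.

(** From exp x >= 1 + x at x = b w, which gives 1 - exp(-x) >= x / (1 + x). *)
Lemma nB_le (w : R) : 0 < w -> nB P w <= 1 + (b * w)^-1.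
Proof.
move=> w0; have x0 : 0 < b * w by rewrite mulr_gt0.
rewrite /nB -lef_pV2 ?posrE ?invrK ?addr_gt0 ?invr_gt0//; last first.
  by rewrite subr_gt0 expR_lt1 oppr_lt0.
have := expR_ge1Dx (b * w); set x := b * w in x0 * => h.
have -> : (1 + x^-1)^-1 = 1 - (1 + x)^-1 by field; lra.
by rewrite lerD2l lerN2 expRN lef_pV2 ?posrE ?expR_gt0//; lra.
Qed.

Lemma nB_le2 (w : R) : b^-1 <= w -> nB P w <= 2.
Proof.
move=> bw; have c0 : 0 < b^-1 by rewrite invr_gt0.
have w0 : 0 < w by lra.
apply: le_trans (nB_le w0) _; suff : (b * w)^-1 <= 1 by lra.
rewrite invf_le1; last exact: mulr_gt0 b0 w0.
by have := ler_wpM2l (ltW b0) bw; rewrite divff ?gt_eqF.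
Qed.

Lemma measurable_nB : measurable_fun [set: R] (nB P).
Proof.
apply: (measurableT_comp (measurable_invr)).
apply: measurable_funB => //; apply: measurableT_comp => //.
apply: measurableT_comp => //.
Qed.

(** For w < 0, [nB_add_nBN] and nB(-w) >= 1 force nB(w) <= 0. *)
Lemma mul_nB_ge0 (w : R) : 0 <= w * nB P w.
Proof.
have [w0|w0|->] := ltgtP w 0; last by rewrite mul0r.
  have Nw0 : 0 < - w by rewrite oppr_gt0.
  have := nB_ge1 Nw0; have := nB_add_nBN (lt0r_neq0 Nw0); rewrite opprK => h1 h2.
  by rewrite nmulr_rge0//; lra.
by rewrite mulr_ge0 ?ltW// (lt_le_trans ltr01) ?nB_ge1.
Qed.

(** For w < 0 reflection gives w nB(w) = |w| nB(|w|) - |w|, which stays below [b^-1]. *)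
Lemma mul_nB_le (w : R) : w * nB P w <= `|w| + b^-1.
Proof.
have pos (u : R) : 0 < u -> u * nB P u <= u + b^-1.
  move=> u0; apply: le_trans (ler_wpM2l (ltW u0) (nB_le u0)) _.
  by rewrite mulrDr mulr1 lerD2l invfM mulrCA divff ?mulr1// gt_eqF.
have [w0|w0|->] := ltgtP w 0; last by rewrite mul0r normr0 add0r invr_ge0 ltW.
  have Nw0 : 0 < - w by rewrite oppr_gt0.
  have := pos _ Nw0; have := nB_add_nBN (lt0r_neq0 Nw0); rewrite opprK ltr0_norm//.
  nra.
by rewrite gtr0_norm//; exact: pos.
Qed.

Lemma sqr_nB_le (w : R) : w ^+ 2 * nB P w <= w ^+ 2 + b^-1 * `|w|.
Proof.
have c0 : 0 < b^-1 by rewrite invr_gt0.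
rewrite expr2 -mulrA; have h0 := mul_nB_ge0 w; have := mul_nB_le w.
have [w0|w0] := ltP w 0; first by rewrite ltr0_norm//; nra.
by rewrite ger0_norm//; nra.
Qed.

End bose_factor.

(** * The weight on a frequency window and its fold under w -> -w *)

Section window.
Context {R : realType} (P : plasma_projectile R).
Local Notation b := (inverse_temperature P * reduced_planck P).
Hypothesis b0 : 0 < b.
Variables lo hi : R.
Hypotheses (hi0 : 0 < hi) (lohi : lo <= hi) (Nhilo : - hi <= lo).

(** The weight is cut off by an indicator rather than by the integration domain, so that integrals
    run over the whole line, where w can be reflected. *)
Definition window (w : R) : R := \1_(`[lo, hi]%classic) w * (w ^+ 2 * nB P w).

Let windowE w : window w = if lo <= w <= hi then w ^+ 2 * nB P w else 0.
Proof.
rewrite /window indicE mem_setE in_itv/=.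
by case: ifP => _; rewrite ?mul1r ?mul0r.
Qed.

(** Since - lo <= hi, both w and -w lie in the window exactly when w <= - lo, and then nB(w) +
    nB(-w) = 1 removes the Bose factor. Otherwise -w falls below lo. *)
Lemma window_fold_pos (w : R) : 0 < w ->
  if w <= - lo then window w + window (- w) = w ^+ 2
  else window w + window (- w) = if lo <= w <= hi then w ^+ 2 * nB P w else 0.
Proof.
move=> w0; move: hi0 lohi Nhilo => hi1 lohi1 Nhilo1.
rewrite !windowE; case: ifPn => [wlo|]; last rewrite -ltNge => wlo.
  have l1 : lo <= w by lra.
  have h1 : w <= hi by lra.
  have l2 : lo <= - w by lra.
  have h2 : - w <= hi by lra.
  rewrite l1 h1 l2 h2.
  by rewrite sqrrN -mulrDr nB_add_nBN ?mulr1// gt_eqF.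
rewrite [X in _ + X]ifF; last by apply/negP => /andP[]; lra.
by rewrite addr0.
Qed.

(** The folded weight is even and vanishes at 0, so an even bound needs checking only for w > 0. *)
Lemma window_fold_ind (p : R -> R -> Prop) :
  p 0 0 -> (forall w y, p (- w) y -> p w y) ->
  (forall w, 0 < w -> p w (window w + window (- w))) ->
  forall w, p w (window w + window (- w)).
Proof.
move=> p0 pN pp w; have [w0|w0|->] := ltgtP w 0.
- by apply: pN; have := pp (- w); rewrite opprK oppr_gt0 addrC; exact.
- exact: pp.
- by rewrite oppr0 /window expr0n/= !(mul0r, mulr0) addr0.
Qed.

Lemma window_fold_ge0 w : 0 <= window w + window (- w).
Proof.
move: w; apply: (window_fold_ind (p := fun _ y => 0 <= y)) => // w w0.
have := window_fold_pos w0; case: ifP => _ ->; first exact: sqr_ge0.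
case: ifP => // _; rewrite mulr_ge0 ?sqr_ge0//.
exact: le_trans ler01 (nB_ge1 b0 w0).
Qed.

(* Plays the role of Chebyshev's inequality: the left-hand side is negative for
   |w| > |lo|. *)
Lemma window_fold_ge w : lo < 0 ->
  w ^+ 2 - (lo ^+ 2)^-1 * w ^+ 4 <= window w + window (- w).
Proof.
move=> lo0; move: w.
apply: (window_fold_ind (p := fun w y => w ^+ 2 - (lo ^+ 2)^-1 * w ^+ 4 <= y)).
- by rewrite !expr0n/= mulr0 subrr.
- by move=> w y; rewrite sqrrN (_ : (- w) ^+ 4 = w ^+ 4)//; ring.
move=> w w0; have := window_fold_ge0 w; have := window_fold_pos w0.
have lo2 : 0 < lo ^+ 2 by rewrite exprn_even_gt0//= lt_eqF.
case: ifPn => [_ -> _|].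
  by rewrite gerBl mulr_ge0// ?invr_ge0 ?ltW// exprn_gt0.
rewrite -ltNge => wlo _; apply: le_trans.
rewrite subr_le0 (exprD w 2 2) mulrA ler_peMl ?sqr_ge0//.
by rewrite mulrC ler_pdivlMr// mul1r; nra.
Qed.

(** The Bose factor survives only for w > - lo >= [b^-1], where it is at most 2. *)
Lemma window_fold_le w : lo <= - b^-1 ->
  window w + window (- w) <= 2 * w ^+ 2.
Proof.
move=> lob; move: w.
apply: (window_fold_ind (p := fun w y => y <= 2 * w ^+ 2)).
- by rewrite expr0n/= mulr0.
- by move=> w y; rewrite sqrrN.
move=> w w0; have := window_fold_pos w0; have w2 := sqr_ge0 w.
case: ifPn => [_ ->|]; first by lra.
rewrite -ltNge => wlo ->; case: ifP => _; last by lra.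
rewrite mulrC ler_wpM2r//; apply: nB_le2 => //; lra.
Qed.

(** The inequality |w| <= 1 + w^2 trades the term linear in |w| for the moments 0 and 2. *)
Lemma window_le w : window w <= (1 + b^-1) * w ^+ 2 + b^-1.
Proof.
have c0 : 0 < b^-1 by rewrite invr_gt0.
have := sqr_nB_le b0 w; have w2 := sqr_ge0 w.
have : `|w| <= 1 + w ^+ 2.
  by rewrite -real_normK ?num_real//; have := normr_ge0 w; set x := `|w|; nra.
rewrite windowE; case: ifP => _; nra.
Qed.

Lemma normr_window_le w : `|window w| <= (1 + b^-1) * (1 + w ^+ 2).
Proof.
have c0 : 0 < b^-1 by rewrite invr_gt0.
have h0 := mul_nB_ge0 b0 w; have h1 := mul_nB_le b0 w.
rewrite windowE; case: ifP => _; last by rewrite normr0; have := sqr_ge0 w; nra.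
have -> : `|w ^+ 2 * nB P w| = `|w| * (w * nB P w).
  by rewrite expr2 -mulrA normrM (ger0_norm h0).
rewrite -[w ^+ 2]real_normK ?num_real//.
apply: le_trans (ler_wpM2l (normr_ge0 w) h1) _.
have := normr_ge0 w; set x := `|w|; set c := b^-1 in c0 *; move=> x0.
have : 0 <= c * (1 - x + x ^+ 2) by apply: mulr_ge0; [exact: ltW|nra].
by lra.
Qed.

(** Spends one factor w on hi and leaves w nB(w), whose integral against the loss function is a
    multiple of S(k) / k^2. *)
Lemma window_le_hi w : window w <= hi * (w * nB P w).
Proof.
have h0 := mul_nB_ge0 b0 w.
rewrite windowE; case: ifP => [/andP[_ whi]|_]; last by rewrite mulr_ge0// ltW.
by rewrite expr2 -mulrA ler_wpM2r.
Qed.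

Lemma measurable_window : measurable_fun [set: R] window.
Proof.
apply: measurable_funM; first exact/measurable_indic.
by apply: measurable_funM; [exact: exprn_measurable|exact: measurable_nB].
Qed.

End window.

Lemma integrable_EFinZl d (T : measurableType d) (R : realType)
    (mu : {measure set T -> \bar R}) (D : set T) (c : R) (f : T -> R) :
  measurable D -> mu.-integrable D (fun x => (f x)%:E) ->
  mu.-integrable D (fun x => (c * f x)%:E).
Proof.
by move=> mD fi; have := integrableZl mD c fi; congr (_.-integrable _ _).
Qed.

(** * Integrals against the loss function at a fixed wavenumber *)

Section loss_integrals.
Context {R : realType} (P : plasma_projectile R) (k : R).
Local Notation b := (inverse_temperature P * reduced_planck P).
Local Notation mu := (@lebesgue_measure R).
Local Notation L := (loss P k).
Hypotheses (b0 : 0 < b) (hA : sum_rules P) (k0 : 0 < k).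

Lemma integrable_loss_moment nu : nu \in [:: 0%N; 2%N; 4%N] ->
  mu.-integrable [set: R] (fun w => (w ^+ nu * L w)%:E).
Proof. by case: hA => _ _ + _; apply. Qed.

Lemma Rintegral_loss_moment nu :
  \int[mu]_w (w ^+ nu * L w) = pi * moment P nu k.
Proof. by rewrite /moment mulrA divff ?mul1r// gt_eqF// pi_gt0. Qed.

Lemma loss_ge0 w : 0 <= L w. Proof. by case: hA => + _ _ _; apply. Qed.

Lemma measurable_loss : measurable_fun [set: R] L.
Proof.
have := measurable_int _ (integrable_loss_moment (mem_head 0%N [:: 2%N; 4%N])).
by under eq_fun do rewrite expr0 mul1r; move/measurable_EFinP.
Qed.

(** Domination by the integrands of the moments 0 and 2. *)
Lemma integrable_mul_loss (f : R -> R) (A : R) : measurable_fun [set: R] f ->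
  (forall w, `|f w| <= A * (1 + w ^+ 2)) ->
  mu.-integrable [set: R] (fun w => (f w * L w)%:E).
Proof.
move=> mf fA.
have ig : mu.-integrable [set: R]
    (fun w => A%:E * ((w ^+ 0 * L w)%:E + (w ^+ 2 * L w)%:E))%E.
  by apply: integrableZl => //; apply: integrableD => //;
    exact: integrable_loss_moment.
apply: le_integrable ig => //.
  by apply/measurable_EFinP; apply: measurable_funM => //; exact: measurable_loss.
move=> w _; rewrite /= lee_fin -mulrDl mulrA !normrM ler_wpM2r//.
by rewrite -normrM expr0; exact: le_trans (fA w) (ler_norm _).
Qed.

Lemma integrable_nB_loss :
  mu.-integrable [set: R] (fun w => (w * nB P w * L w)%:E).
Proof.
apply: (@integrable_mul_loss _ (1 + b^-1)).
  by apply: measurable_funM => //; exact: measurable_nB.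
move=> w; rewrite ger0_norm ?mul_nB_ge0//; apply: le_trans (mul_nB_le b0 w) _.
rewrite -[w ^+ 2]real_normK ?num_real//.
have : 0 < b^-1 by rewrite invr_gt0.
set x := `|w|; set c := b^-1 => c0.
have : 0 <= c * x ^+ 2 by rewrite mulr_ge0 ?sqr_ge0// ltW.
by have := sqr_ge0 (x - 1); have := sqr_ge0 x; lra.
Qed.

Lemma mul_nB_im (w : R) :
  w * nB P w * - complex.Im (inv_dielectric P k w) = w ^+ 2 * nB P w * L w.
Proof.
rewrite /loss; have [->|w0] := eqVneq w 0; first by rewrite expr0n/= !mul0r.
by field.
Qed.

(** Fluctuation-dissipation fixes S(k, w) for w <> 0 only, so the two integrands are compared almost
    everywhere. *)
Lemma Rintegral_nB_loss : fluctuation_dissipation P ->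
  0 < reduced_planck P -> 0 < elementary_charge P -> 0 < electron_density P ->
  \int[mu]_w (w * nB P w * L w) =
  4 * pi ^+ 2 * elementary_charge P ^+ 2 * electron_density P / reduced_planck P
  * (static_structure P k / k ^+ 2).
Proof.
move=> hC h0 e0 n0.
set A := 4 * pi ^+ 2 * elementary_charge P ^+ 2 / (reduced_planck P * k ^+ 2).
have A0 : 0 < A by rewrite divr_gt0 ?mulr_gt0 ?exprn_gt0 ?pi_gt0.
have SE w : w != 0 -> dyn_structure P k w = A^-1 * (w * nB P w * L w).
  move=> w0; have [_ /(_ w0) h] := hC k w k0.
  have -> : w * nB P w * L w = A * dyn_structure P k w.
    by rewrite -h /loss; field.
  by rewrite mulKf// gt_eqF.
have iS := integrable_nB_loss.
have -> : \int[mu]_w (w * nB P w * L w) = A * \int[mu]_w dyn_structure P k w.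
  rewrite -[LHS](mulVKf (lt0r_neq0 A0)); congr (_ * _).
  rewrite -RintegralZl//; congr fine; apply: ae_eq_integral => //.
  - apply: measurableT_comp => //; apply: measurable_funM => //.
    by have /measurable_EFinP := measurable_int _ iS.
  (* Measurability of S(k, .): its value at w = 0, which the relation leaves free, is carried by the
     indicator of {0}. *)
  - rewrite (_ : (fun w => _) = EFin \o (fun w => A^-1 * (w * nB P w * L w) +
        dyn_structure P k 0 * \1_[set 0] w)).
      apply/measurable_EFinP; apply: measurable_funD; apply: measurable_funM => //.
      by have /measurable_EFinP := measurable_int _ iS.
    apply/funext => w /=; congr EFin; rewrite indicE.
    have [->|w0] := eqVneq w 0; first by rewrite mem_set// mulr1 !mul0r mulr0 add0r.
    by rewrite memNset ?mulr0 ?addr0 ?SE// => /eqP; rewrite (negbTE w0).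
  exists [set 0]; split => //; first exact: lebesgue_measure_set1.
  move=> w /= /existsNP[_ h]; apply/eqP; apply: contra_notT h => w0.
  by rewrite SE.
rewrite /static_structure /A; field.
by rewrite !gt_eqF.
Qed.

(** * Bounds on the integral over a frequency window *)

Section window_integral.
Variables lo hi : R.
Hypotheses (hi0 : 0 < hi) (lohi : lo <= hi) (Nhilo : - hi <= lo).

Local Notation I := (\int[mu]_(w in `[lo, hi])
  (w * nB P w * - complex.Im (inv_dielectric P k w))).

Let windowI : I = \int[mu]_w (window P lo hi w * L w).
Proof.
rewrite Rintegral_mkcond; apply: eq_Rintegral => w _.
rewrite patchE /window indicE; case: ifP => _; last by rewrite !mul0r.
by rewrite mul1r mul_nB_im.
Qed.

Let iwindow : mu.-integrable [set: R] (fun w => (window P lo hi w * L w)%:E).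
Proof.
apply: (@integrable_mul_loss _ (1 + b^-1)); first exact: measurable_window.
exact: normr_window_le.
Qed.

Let iwindowN : mu.-integrable [set: R] (fun w => (window P lo hi (- w) * L w)%:E).
Proof.
have := integrable_oppr iwindow; congr (_.-integrable _ _).
by apply/funext => w; case: hA => _ -> .
Qed.

Let ifold : mu.-integrable [set: R]
  (fun w => ((window P lo hi w + window P lo hi (- w)) * L w)%:E).
Proof.
under eq_fun do rewrite mulrDl EFinD.
exact: integrableD.
Qed.

(** As L is even, the reflected weight has the same integral against L. *)
Let foldI : I = 2^-1 *
  \int[mu]_w ((window P lo hi w + window P lo hi (- w)) * L w).
Proof.
under [in RHS]eq_Rintegral do rewrite mulrDl.
rewrite RintegralD//.
have -> : \int[mu]_w (window P lo hi (- w) * L w) = I.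
  rewrite windowI -(Rintegral_oppr iwindow); apply: eq_Rintegral => w _.
  by case: hA => _ -> .
by rewrite -windowI; lra.
Qed.

Lemma stopping_window_ge0 : 0 <= I.
Proof.
rewrite foldI mulr_ge0// Rintegral_ge0// => w _.
by rewrite mulr_ge0 ?loss_ge0// window_fold_ge0.
Qed.

Lemma stopping_window_ge : lo < 0 ->
  pi / 2 * (moment P 2 k - (lo ^+ 2)^-1 * moment P 4 k) <= I.
Proof.
move=> lo0; rewrite foldI.
rewrite [leLHS](_ : _ = 2^-1 *
  (pi * moment P 2 k - (lo ^+ 2)^-1 * (pi * moment P 4 k))); last by ring.
have i2 := @integrable_loss_moment 2 isT; have i4 := @integrable_loss_moment 4 isT.
rewrite ler_wpM2l// -!Rintegral_loss_moment -RintegralZl// -RintegralB//; last first.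
  exact: integrable_EFinZl.
apply: le_Rintegral => //.
  have := integrableB measurableT i2 (integrable_EFinZl (lo ^+ 2)^-1 measurableT i4).
  by congr (_.-integrable _ _).
move=> w _; rewrite mulrA -mulrBl ler_wpM2r ?loss_ge0//.
exact: window_fold_ge.
Qed.

Lemma stopping_window_le : lo <= - b^-1 -> I <= pi * moment P 2 k.
Proof.
move=> lob; rewrite foldI -Rintegral_loss_moment.
have i2 := @integrable_loss_moment 2 isT.
rewrite ler_pdivrMl// -RintegralZl//; apply: le_Rintegral => //.
  exact: integrable_EFinZl.
move=> w _; rewrite mulrA ler_wpM2r ?loss_ge0//.
exact: window_fold_le.
Qed.

(** Holds whatever the sign of lo, as needed near the zero of [alpha_m]; the price is the moment
    C_0. *)
Lemma stopping_window_le_moments :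
  I <= pi * ((1 + b^-1) * moment P 2 k + b^-1 * moment P 0 k).
Proof.
rewrite windowI [leRHS](_ : _ = (1 + b^-1) * (pi * moment P 2 k) +
  b^-1 * (pi * moment P 0 k)); last by ring.
have i2 := @integrable_loss_moment 2 isT; have i0 := @integrable_loss_moment 0 isT.
rewrite -!Rintegral_loss_moment -!RintegralZl//.
rewrite -RintegralD//; [|exact: integrable_EFinZl..].
apply: le_Rintegral => //.
  have := integrableD measurableT (integrable_EFinZl (1 + b^-1) measurableT i2)
    (integrable_EFinZl b^-1 measurableT i0).
  by congr (_.-integrable _ _).
move=> w _; rewrite [leRHS](_ : _ = ((1 + b^-1) * w ^+ 2 + b^-1) * L w); last by ring.
rewrite ler_wpM2r ?loss_ge0//.
exact: window_le.
Qed.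

Lemma stopping_window_le_hi : I <= hi * \int[mu]_w (w * nB P w * L w).
Proof.
have i := integrable_nB_loss.
rewrite windowI -RintegralZl//; apply: le_Rintegral => //.
  exact: integrable_EFinZl.
move=> w _; rewrite mulrA ler_wpM2r ?loss_ge0//.
exact: window_le_hi.
Qed.

(** On such a window nB <= 2 and w <= hi, which leaves the mass of L that the decay condition
    controls. *)
Lemma stopping_window_le_loss : b^-1 <= lo ->
  I <= 2 * hi ^+ 2 * \int[mu]_(w in `[lo, hi]) L w.
Proof.
move=> blo; have c0 : 0 < b^-1 by rewrite invr_gt0.
have iL : mu.-integrable `[lo, hi] (EFin \o L).
  have := @integrable_loss_moment 0 isT.
  under eq_fun do rewrite expr0 mul1r.
  exact: integrableS.
rewrite windowI -RintegralZl// [leRHS]Rintegral_mkcond.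
apply: le_Rintegral => //.
  rewrite -restrict_EFin; apply/integrable_restrict => //=.
  rewrite setTI; exact: integrable_EFinZl.
move=> w _; rewrite patchE /window indicE; case: ifPn; last by rewrite !mul0r.
rewrite mem_setE in_itv/= => /andP[low whi]; rewrite mul1r ler_wpM2r ?loss_ge0//.
have w0 : 0 < w by lra.
rewrite [leRHS]mulrC; apply: ler_pM; rewrite ?sqr_ge0//.
- exact: le_trans ler01 (nB_ge1 b0 w0).
- by rewrite ler_pXn2r// nnegrE ltW.
by apply: nB_le2 => //; lra.
Qed.

End window_integral.
End loss_integrals.

(** * Integration over the wavenumber *)

Section outer_integral.
Context {R : realType}.
Local Notation mu := (@lebesgue_measure R).

Lemma integral_inv (a c : R) : 0 < a -> a < c ->
  (\int[mu]_(x in `[a, c]) (x^-1)%:E = (ln c - ln a)%:E)%E.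
Proof.
move=> a0 ac; rewrite (@continuous_FTC2 _ _ (@ln R))//.
- apply: continuous_in_subspaceT => x; rewrite inE/= in_itv/= => /andP[ax _].
  by apply: inv_continuous; rewrite gt_eqF// (lt_le_trans a0).
- split.
  + move=> x; rewrite in_itv/= => /andP[ax _].
    by apply: ex_derive; apply: is_derive1_ln; exact: lt_trans ax.
  + by apply: cvg_at_right_filter; exact: continuous_ln.
  + by apply: cvg_at_left_filter; apply: continuous_ln; exact: lt_trans ac.
- move=> x; rewrite in_itv/= => /andP[ax _].
  by rewrite derive1E; apply: derive_val; apply: is_derive1_ln; exact: lt_trans ax.
Qed.

Lemma integral_invX2 (c : R) : 0 < c ->
  (\int[mu]_(x in `[c, +oo[) (x ^- 2)%:E = (c^-1)%:E)%E.
Proof.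
move=> c0; have cx x : c <= x -> x != 0 by move=> /(lt_le_trans c0) /lt0r_neq0.
have dV (x : R) : c <= x -> is_derive x 1 (fun y : R => - y^-1) (x ^- 2).
  move=> /cx x0; have := is_deriveN (is_deriveV (f := id) x0 (is_derive_id x 1)).
  by rewrite scaleNr opprK /GRing.scale/= mulr1.
rewrite (@ge0_continuous_FTC2y _ _ (fun x : R => - x^-1) _ 0).
- by rewrite sub0e -EFinN opprK.
- by move=> x cx'; rewrite invr_ge0 sqr_ge0.
- apply: continuous_in_subspaceT => x; rewrite inE/= in_itv/= andbT => /cx x0.
  apply: (@continuousV _ _ (fun y : R => y ^+ 2)); first by rewrite expf_neq0.
  exact: exprn_continuous.
- rewrite -oppr0; apply: cvgN; apply/(gtr0_cvgV0 (f := id)); last exact: cvg_id.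
  exact: nbhs_pinfty_gt.
- by move=> x /ltW /dV h; exact: ex_derive.
- apply: cvg_at_right_filter; apply: cvgN; apply: inv_continuous; exact: lt0r_neq0.
- move=> x; rewrite in_itv/= andbT => /ltW /dV h.
  by rewrite derive1E; exact: derive_val.
Qed.

(** [F] is not assumed measurable, so additivity is applied to a measurable majorant, the sum of
    three nonnegative pieces extended by 0. *)
Lemma integral_outer_le (F : R -> R) (a c A1 A2 A3 : R) :
  0 < a -> a < c -> 0 <= A1 -> 0 <= A2 -> 0 <= A3 ->
  (forall k, 0 < k -> 0 <= F k) ->
  (forall k, 0 < k -> k < a -> F k <= A1) ->
  (forall k, a <= k -> k <= c -> F k <= A2 * k^-1) ->
  (forall k, c <= k -> F k <= A3 * k ^- 2) ->
  (\int[mu]_(k in `]0%R, +oo[) (F k)%:E <=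
     (A1 * a + A2 * (ln c - ln a) + A3 * c^-1)%:E)%E.
Proof.
move=> a0 ac A10 A20 A30 F0 F1 F2 F3.
pose f1 := (fun _ : R => A1%:E) \_ `[0, a].
pose f2 := (fun k : R => (A2 * k^-1)%:E) \_ `[a, c].
pose f3 := (fun k : R => (A3 * k ^- 2)%:E) \_ `[c, +oo[.
have c0 : 0 < c := lt_trans a0 ac.
have f10 x : (0 <= f1 x)%E by apply: erestrict_ge0 => *; rewrite lee_fin.
have f20 x : (0 <= f2 x)%E.
  apply: erestrict_ge0 => y /=; rewrite in_itv/= => /andP[ay _].
  by rewrite lee_fin mulr_ge0// invr_ge0 ltW// (lt_le_trans a0).
have f30 x : (0 <= f3 x)%E.
  by apply: erestrict_ge0 => y _; rewrite lee_fin mulr_ge0// invr_ge0 sqr_ge0.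
have mf1 : measurable_fun setT f1 by apply/(measurable_restrictT _ _).1.
have mf2 : measurable_fun setT f2.
  apply/(measurable_restrictT _ _).1 => //; apply/measurable_EFinP/measurable_funTS.
  by apply: measurable_funM => //; exact: measurable_invr.
have mf3 : measurable_fun setT f3.
  apply/(measurable_restrictT _ _).1 => //; apply/measurable_EFinP/measurable_funTS.
  apply: measurable_funM => //; apply: (measurableT_comp measurable_invr).
  exact: exprn_measurable.
rewrite integral_mkcond.
apply: (@le_trans _ _ (\int[mu]_x (f1 x + (f2 x + f3 x)))%E).
  apply: ge0_le_integral_lower => x _.
    by apply: erestrict_ge0 => y /=; rewrite in_itv/= andbT lee_fin => /F0.
  rewrite patchE mem_setE in_itv/= andbT; case: ifPn => x0; last by rewrite !adde_ge0.
  have [xa|ax] := ltP x a.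
    apply: le_trans (leeDl _ _); last by rewrite adde_ge0.
    by rewrite /f1 patchE mem_setE in_itv/= (ltW x0) (ltW xa) lee_fin F1.
  have [xc|cx] := leP x c.
    apply: le_trans (leeDr _ _) => //; apply: le_trans (leeDl _ _) => //.
    by rewrite /f2 patchE mem_setE in_itv/= ax xc lee_fin F2.
  apply: le_trans (leeDr _ _) => //; apply: le_trans (leeDr _ _) => //.
  by rewrite /f3 patchE mem_setE in_itv/= (ltW cx) lee_fin F3// ltW.
rewrite ge0_integralD//; last 2 first.
  by move=> x _; rewrite adde_ge0.
  exact: emeasurable_funD.
rewrite ge0_integralD//.
rewrite -!integral_mkcond integral_cst//= lebesgue_measure_itv/= lte_fin a0 sube0.
under [X in (_ + (X + _))%E]eq_integral do rewrite EFinM.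
under [X in (_ + (_ + X))%E]eq_integral do rewrite EFinM.
rewrite ge0_integralZl//; last 2 first.
- apply/measurable_EFinP/measurable_funTS; exact: measurable_invr.
- move=> x /=; rewrite in_itv/= => /andP[ax _].
  by rewrite lee_fin invr_ge0 ltW// (lt_le_trans a0).
rewrite ge0_integralZl//; last 2 first.
- apply/measurable_EFinP/measurable_funTS; apply: (measurableT_comp measurable_invr).
  exact: exprn_measurable.
- by move=> x _; rewrite lee_fin invr_ge0 sqr_ge0.
by rewrite integral_inv// integral_invX2// -!EFinM -!EFinD addrA.
Qed.

Lemma integral_outer_ge (F : R -> R) (K A : R) : 0 < K -> 0 <= A ->
  (forall k, 0 < k -> 0 <= F k) ->
  (forall k, K <= k -> k <= 2 * K -> A <= F k) ->
  ((A * K)%:E <= \int[mu]_(k in `]0%R, +oo[) (F k)%:E)%E.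
Proof.
move=> K0 A0 F0 FA.
apply: (@le_trans _ _ (\int[mu]_(k in `[K, (2 * K)%R]) A%:E)%E).
  rewrite integral_cst//= lebesgue_measure_itv/= lte_fin ifT; last by lra.
  by rewrite -EFinM lee_fin ler_wpM2l//; lra.
rewrite integral_mkcond [leRHS]integral_mkcond.
apply: ge0_le_integral_lower => x _; first by apply: erestrict_ge0 => *; rewrite lee_fin.
rewrite !patchE !mem_setE !in_itv/= andbT; case: ifPn => [/andP[Kx xK]|_].
  by rewrite (lt_le_trans K0 Kx) lee_fin FA.
by case: ifPn => // x0; rewrite lee_fin F0.
Qed.

End outer_integral.

Lemma near_pinfty_gt0 {R : realType} (Q : R -> Prop) :
  (\forall x \near +oo, Q x) -> exists2 K, 0 < K & forall x, K <= x -> Q x.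
Proof.
(* [KQ] needs x > K strictly, and the threshold must be positive; hence the added 1. *)
move=> [K [_ KQ]]; exists (Num.max K 0 + 1).
  by rewrite ltr_wpDl// le_max lexx orbT.
move=> x Kx; apply: KQ; apply: lt_le_trans Kx.
by rewrite ltr_pwDr// le_max lexx.
Qed.

(** * The stopping power of the projectile *)

Section stopping.
Context {R : realType} (P : plasma_projectile R).
Local Notation Zp := (charge_number P).
Local Notation e := (elementary_charge P).
Local Notation m := (electron_mass P).
Local Notation M := (projectile_mass P).
Local Notation n := (electron_density P).
Local Notation hbar := (reduced_planck P).
Local Notation beta := (inverse_temperature P).
Local Notation vF := (fermi_velocity P).
Local Notation kF := (fermi_wavenumber P).
Local Notation omega_p := (plasma_freq P).
Local Notation mu := (@lebesgue_measure R).
Local Notation c := ((beta * hbar)^-1).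

Definition inner_integral (v k : R) : R :=
  \int[mu]_(w in `[alpha_m P v k, alpha_p P v k])
    (w * nB P w * - complex.Im (inv_dielectric P k w)).

Hypotheses (hconst : admissible_constants P) (hA : sum_rules P).

Let hbar0 : 0 < hbar. Proof. by case: hconst => _ []. Qed.
Let beta0 : 0 < beta. Proof. by case: hconst => _ []. Qed.
Let b0 : 0 < beta * hbar. Proof. exact: mulr_gt0. Qed.
Let c0 : 0 < c. Proof. by rewrite invr_gt0. Qed.
Let n0 : 0 < n. Proof. by case: hconst => _ []. Qed.
Let e0 : 0 < e. Proof. by case: hconst => -[]. Qed.
Let Zp0 : 0 < Zp. Proof. by case: hconst => -[]. Qed.
Let m0 : 0 < m. Proof. by case: hconst => -[]. Qed.
Let M0 : 0 < M. Proof. by apply: lt_trans m0 _; case: hconst => -[]. Qed.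
Let vF0 : 0 < vF. Proof. by case: hconst => _ _ []. Qed.
Let kF0 : 0 < kF. Proof. by case: hconst => _ _ []. Qed.

Lemma plasma_freq_gt0 : 0 < omega_p.
Proof. by rewrite sqrtr_gt0 divr_gt0 ?mulr_gt0 ?exprn_gt0 ?pi_gt0. Qed.

Let recoilE k : hbar * k ^+ 2 / (2 * M) = k * (hbar * k / (2 * M)).
Proof. by field; exact: lt0r_neq0 M0. Qed.

Let recoil_gt0 k : 0 < k -> 0 < hbar * k / (2 * M).
Proof. by move=> k0; rewrite divr_gt0 ?mulr_gt0. Qed.

Lemma alpha_p_gt0 v k : 0 < v -> 0 < k -> 0 < alpha_p P v k.
Proof.
move=> v0 k0; rewrite /alpha_p recoilE addr_gt0 ?(mulr_gt0 k0)//.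
exact: recoil_gt0.
Qed.

Lemma alpha_m_le_p v k : 0 < v -> 0 < k -> alpha_m P v k <= alpha_p P v k.
Proof.
by move=> v0 k0; rewrite /alpha_p /alpha_m; have := mulr_gt0 k0 v0; lra.
Qed.

Lemma alpha_pN_le_m v k : 0 < v -> 0 < k -> - alpha_p P v k <= alpha_m P v k.
Proof.
move=> v0 k0; rewrite /alpha_p /alpha_m recoilE.
by have := mulr_gt0 k0 (recoil_gt0 k0); set r := k * _; lra.
Qed.

(** The hypothesis on k makes the recoil term hbar k^2 / (2M) at most k v / 2. *)
Lemma alpha_bounds v k : 0 < v -> 0 < k -> hbar * k <= M * v ->
  alpha_m P v k <= - (k * v / 2) /\ alpha_p P v k <= 2 * (k * v).
Proof.
move=> v0 k0 hkv; have r0 := recoil_gt0 k0; rewrite /alpha_p /alpha_m recoilE.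
have : k * (hbar * k / (2 * M)) <= k * (v / 2).
  rewrite (ler_wpM2l (ltW k0))// ler_pdivrMr ?mulr_gt0//.
  by rewrite [leRHS](_ : _ = M * v)//; field.
rewrite mulrA; have := mulr_gt0 k0 v0; set r := k * (_ / _).
by split; lra.
Qed.

Lemma inner_integral_ge0 v k : 0 < v -> 0 < k -> 0 <= inner_integral v k.
Proof.
move=> v0 k0; apply: stopping_window_ge0 => //.
- exact: alpha_p_gt0.
- exact: alpha_m_le_p.
- exact: alpha_pN_le_m.
Qed.

(** * Bounds on the inner integral *)

Lemma moment2E k : 0 < k -> moment P 2 k = omega_p ^+ 2.
Proof. by move=> k0; case: hA => _ _ _ /(_ k k0) []. Qed.

(** U converges at infinity, hence is bounded above for large k, which fixes K; the kinetic term is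
    increasing, so its value at 2K bounds it. *)
Lemma moment4_bounded : correlation_terms P ->
  exists2 K, 0 < K & exists2 D, 0 < D &
    forall k, K <= k -> k <= 2 * K -> moment P 4 k <= D.
Proof.
move=> [_ _ _ _ [h hee]].
have /near_pinfty_gt0[K K0 eeK] : \forall k \near +oo, ee_term P k <= - h / 3 + 1.
  apply: (cvgr_le _ hee); lra.
exists K => //.
(* An upper bound for the bracket in the fourth sum rule; [|X| + 1] is positive whatever the sign of
   [X]. *)
set X := 1 + kinetic_term P (2 * K) + (- h / 3 + 1) + hydrogen_const P.
exists (omega_p ^+ 4 * (`|X| + 1)).
  by rewrite mulr_gt0 ?exprn_gt0 ?plasma_freq_gt0// ltr_wpDl.
move=> k Kk k2K; have k0 : 0 < k := lt_le_trans K0 Kk.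
have [_ _ _ /(_ k k0)[_ _ ->]] := hA.
rewrite (ler_wpM2l (exprn_ge0 4 (ltW plasma_freq_gt0)))//.
have : kinetic_term P k <= kinetic_term P (2 * K).
  rewrite /kinetic_term ler_wpM2r ?invr_ge0 ?sqr_ge0//.
  have kx p : k ^+ p <= (2 * K) ^+ p by rewrite lerXn2r ?nnegrE; lra.
  rewrite lerD// ?ler_wpM2l//; first by case: hconst.
  by rewrite ler_wpM2r ?invr_ge0 ?sqr_ge0// ler_wpM2l ?sqr_ge0.
by have := eeK k Kk; have := ler_norm X; rewrite /X; lra.
Qed.

Lemma inner_integral_ge : correlation_terms P ->
  exists2 K, 0 < K & \forall v \near +oo, forall k, K <= k -> k <= 2 * K ->
    pi / 4 * omega_p ^+ 2 <= inner_integral v k.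
Proof.
move=> /moment4_bounded[K K0 [D D0 KD]]; exists K => //.
have wp0 := plasma_freq_gt0.
near=> v => k Kk k2K; have k0 : 0 < k := lt_le_trans K0 Kk.
have v1 : 1 <= v by near: v; exact: nbhs_pinfty_ge.
have v0 : 0 < v by lra.
have hkv : hbar * k <= M * v.
  apply: (@le_trans _ _ (hbar * (2 * K))); first by rewrite ler_wpM2l// ltW.
  by rewrite -ler_pdivrMl//; near: v; exact: nbhs_pinfty_ge.
have [am _] := alpha_bounds v0 k0 hkv.
have kv0 := mulr_gt0 k0 v0.
have am0 : alpha_m P v k < 0 by lra.
(* Makes C_4 / alpha_m^2 at most half of C_2. Since v >= 1, the bound v <= v^2 reduces this to a
   threshold on v itself. *)
have am2 : 2 * D / omega_p ^+ 2 <= alpha_m P v k ^+ 2.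
  apply: (@le_trans _ _ (v * (K ^+ 2 / 4))).
    rewrite -ler_pdivrMr ?divr_gt0 ?exprn_gt0//.
  apply: (@le_trans _ _ ((K * v / 2) ^+ 2)).
    rewrite [leRHS](_ : _ = v * v * (K ^+ 2 / 4)); last by field.
    by rewrite ler_wpM2r ?divr_ge0 ?sqr_ge0// ler_peMl// ltW.
  rewrite -[leRHS]sqrrN ler_pXn2r ?nnegrE//; last 2 first.
  - by rewrite !mulr_ge0// ltW.
  - by rewrite oppr_ge0 ltW.
  have : K * v <= k * v by rewrite ler_wpM2r// ltW.
  by lra.
have := stopping_window_ge b0 hA k0 (alpha_p_gt0 v0 k0) (alpha_m_le_p v0 k0)
  (alpha_pN_le_m v0 k0) am0.
apply: le_trans; rewrite moment2E//.
have a0 : 0 < alpha_m P v k ^+ 2 by rewrite exprn_even_gt0//= lt_eqF.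
have : (alpha_m P v k ^+ 2)^-1 * moment P 4 k <= omega_p ^+ 2 / 2.
  apply: (@le_trans _ _ ((alpha_m P v k ^+ 2)^-1 * D)).
    by rewrite ler_wpM2l ?invr_ge0 ?sqr_ge0// KD.
  rewrite ler_pdivrMl// -ler_pdivrMr ?divr_gt0 ?exprn_gt0//.
  rewrite [leLHS](_ : _ = 2 * D / omega_p ^+ 2)//.
  by field; exact: lt0r_neq0.
have p0 := pi_gt0 R; set Y := _^-1 * _ => hY.
rewrite [leLHS](_ : _ = pi / 2 * (omega_p ^+ 2 / 2)); last by field.
by rewrite (ler_wpM2l (ltW (divr_gt0 p0 (ltr0Sn R 1))))//; lra.
Unshelve. all: by end_near. Qed.

(** Perfect screening keeps S(k) / k^2 below s + 1 near k = 0; the radius d and the constant T do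
    not depend on v. *)
Lemma inner_integral_le_small_k : fluctuation_dissipation P -> perfect_screening P ->
  exists2 d, 0 < d & exists2 T, 0 < T & forall v k, 0 < v -> 0 < k -> k < d ->
    inner_integral v k <= alpha_p P v k * T.
Proof.
move=> hC [s hs _].
set Q := 4 * pi ^+ 2 * e ^+ 2 * n / hbar.
have Q0 : 0 < Q by rewrite divr_gt0 ?mulr_gt0 ?exprn_gt0 ?pi_gt0.
have : \forall k \near 0^'+, static_structure P k / k ^+ 2 <= s + 1.
  by apply: (cvgr_le _ hs); rewrite ltrDl.
move=> [d /= d0 hd]; exists d => //.
exists (Q * (`|s| + 1)); first by rewrite mulr_gt0// ltr_wpDl.
move=> v k v0 k0 kd.
apply: (le_trans (stopping_window_le_hi b0 hA k0 _ (alpha_p_gt0 v0 k0))).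
rewrite (ler_wpM2l (ltW (alpha_p_gt0 v0 k0)))//.
rewrite (Rintegral_nB_loss b0 hA k0)// -/Q (ler_wpM2l (ltW Q0))//.
apply: (@le_trans _ _ (s + 1)); last by rewrite lerD2r ler_norm.
by apply: hd => //=; rewrite sub0r normrN gtr0_norm.
Qed.

(** The split is at the K beyond which C_0 is bounded, fixed before v. Below K the recoil is
    negligible for large v, and k v >= 2c forces alpha_m <= -c. Above K, where alpha_m may vanish,
    C_0 and C_2 suffice. *)
Lemma inner_integral_le_moderate_k : bounded_static_response P ->
  exists2 A, 0 < A & \forall v \near +oo, forall k, 2 * c / v <= k ->
    inner_integral v k <= A.
Proof.
move=> [B0 /near_pinfty_gt0[K K0 KB]].
have wp2 : 0 < omega_p ^+ 2 by rewrite exprn_gt0// plasma_freq_gt0.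
have p0 := pi_gt0 R.
set A := pi * ((1 + c) * omega_p ^+ 2 + c * `|B0|).
have cB : 0 <= c * `|B0| by rewrite mulr_ge0// ltW.
have cw : 0 < c * omega_p ^+ 2 by rewrite mulr_gt0.
exists A; first by rewrite mulr_gt0//; lra.
near=> v => k ak.
have v0 : 0 < v by near: v; exact: nbhs_pinfty_gt.
have k0 : 0 < k by apply: lt_le_trans ak; rewrite divr_gt0// mulr_gt0.
have [kK|/ltW Kk] := leP k K; last first.
  apply: (le_trans (stopping_window_le_moments b0 hA k0 _ _)).
  rewrite (ler_wpM2l (ltW p0))// moment2E// lerD2l (ler_wpM2l (ltW c0))//.
  exact: le_trans (KB k Kk) (ler_norm _).
have hkv : hbar * k <= M * v.
  apply: (@le_trans _ _ (hbar * K)); first by rewrite (ler_wpM2l (ltW hbar0)).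
  by rewrite -ler_pdivrMl//; near: v; exact: nbhs_pinfty_ge.
have [am _] := alpha_bounds v0 k0 hkv.
have kvc : 2 * c <= k * v by rewrite -ler_pdivrMr.
apply: (@le_trans _ _ (pi * moment P 2 k)).
  apply: (stopping_window_le b0 hA k0 (alpha_p_gt0 v0 k0) (alpha_m_le_p v0 k0)
    (alpha_pN_le_m v0 k0)).
  by move: kvc am; set x := c; lra.
by rewrite moment2E// (ler_wpM2l (ltW p0))//; lra.
Unshelve. all: by end_near. Qed.

(** Here recoil dominates: the window is positive, has width 2 k v, and alpha_p >= hbar k^2 / (2M).
    The decay condition leaves at most 2 alpha_p^2 (omega_p / alpha_p)^3 (2 k v / omega_p), a
    multiple of k v / alpha_p. *)
Lemma inner_integral_le_large_k : holder_decay P ->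
  \forall v \near +oo, forall k, kF * v ^+ 2 / vF ^+ 2 <= k ->
    inner_integral v k <= 8 * M * omega_p ^+ 2 / hbar * v * k^-1.
Proof.
move=> [Sigma hS [nu [mu' [/andP[nu0 nu1] mu3 hH]]]].
have wp0 := plasma_freq_gt0.
near=> v => k ck.
have v1 : 1 <= v by near: v; exact: nbhs_pinfty_ge.
have v0 : 0 < v by lra.
have hHv : forall k, kF * v ^+ 2 / vF ^+ 2 <= k ->
    `|Sigma k (alpha_p P v k) - Sigma k (alpha_m P v k)|
      <= (omega_p / alpha_p P v k) `^ mu'
         * `|(alpha_p P v k - alpha_m P v k) / omega_p| `^ nu.
  by near: v; exact: hH.
set cv := kF * v ^+ 2 / vF ^+ 2 in ck.
have cvE : cv = kF / vF ^+ 2 * v * v by rewrite /cv; field; exact: lt0r_neq0.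
have kFv0 : 0 < kF / vF ^+ 2 by rewrite divr_gt0// exprn_gt0.
have cv_v (X : R) : X <= kF / vF ^+ 2 * v -> X * v <= cv.
  by move=> h; rewrite cvE (ler_wpM2r (ltW v0)).
(* The cut-off grows like v^2 and so exceeds any multiple of v; this multiple makes the recoil term
   at least 2 k v, whence alpha_m >= k v. *)
have hk : 4 * M * v <= hbar * k.
  rewrite -ler_pdivrMl//; apply: le_trans ck; rewrite mulrA; apply: cv_v.
  by rewrite -ler_pdivrMl//; near: v; exact: nbhs_pinfty_ge.
have kX (X : R) : 0 <= X -> X <= kF / vF ^+ 2 * v -> X <= k.
  move=> X0 h; apply: le_trans ck; apply: le_trans (cv_v _ h).
  by rewrite ler_peMr.
have k0 : 0 < k by apply: lt_le_trans ck; rewrite cvE (mulr_gt0 (mulr_gt0 kFv0 v0)).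
have kc : c <= k.
  apply: kX; first exact: ltW.
  by rewrite -ler_pdivrMl//; near: v; exact: nbhs_pinfty_ge.
have kw : omega_p <= k.
  apply: kX; first exact: ltW.
  by rewrite -ler_pdivrMl//; near: v; exact: nbhs_pinfty_ge.
have kkv : k <= k * v by rewrite ler_peMr// ltW.
have rk : 2 * (k * v) <= hbar * k ^+ 2 / (2 * M).
  rewrite recoilE mulrCA (ler_wpM2l (ltW k0))// ler_pdivlMr ?mulr_gt0//.
  by rewrite [leLHS](_ : _ = 4 * M * v)//; ring.
have ap : hbar * k ^+ 2 / (2 * M) <= alpha_p P v k.
  by rewrite /alpha_p lerDr mulr_ge0// ltW.
have am : k * v <= alpha_m P v k by rewrite /alpha_m; lra.
have ap0 := alpha_p_gt0 v0 k0.
apply: (le_trans (stopping_window_le_loss b0 hA k0 ap0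
  (le_trans kc (le_trans kkv am)))).
rewrite -hS//; last exact: alpha_m_le_p.
have hHk := hHv k ck.
set ap' := alpha_p P v k in ap ap0 hHk *.
(* The base is at most 1, so the exponent may be lowered to 3. *)
have h1 : (omega_p / ap') `^ mu' <= (omega_p / ap') ^+ 3.
  rewrite -powR_mulrn; last by rewrite divr_ge0 ?ltW.
  apply: ger_powR => //; rewrite divr_gt0//= ler_pdivrMr// mul1r.
  apply: le_trans kw (le_trans kkv _); apply: le_trans ap.
  by apply: le_trans rk; have := mulr_gt0 k0 v0; lra.
(* The base is at least 1, so raising the exponent to 1 only enlarges the power. *)
have h2 : `|(ap' - alpha_m P v k) / omega_p| `^ nu <= 2 * (k * v) / omega_p.
  have -> : ap' - alpha_m P v k = 2 * (k * v).
    by rewrite /ap' /alpha_p /alpha_m; lra.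
  have kv0 := mulr_gt0 k0 v0.
  have q1 : 1 <= 2 * (k * v) / omega_p.
    by rewrite ler_pdivlMr// mul1r; lra.
  rewrite ger0_norm; last exact: le_trans ler01 q1.
  rewrite -[leRHS]powRr1; last exact: le_trans ler01 q1.
  exact: ler_powR.
apply: (@le_trans _ _ (2 * ap' ^+ 2 *
  ((omega_p / ap') ^+ 3 * (2 * (k * v) / omega_p)))).
  rewrite (ler_wpM2l (mulr_ge0 (ler0n R 2) (sqr_ge0 ap')))//.
  apply: (le_trans (ler_norm _)); apply: (le_trans hHk).
  by apply: ler_pM => //; exact: powR_ge0.
rewrite [leLHS](_ : _ = 4 * omega_p ^+ 2 * (k * v) * ap'^-1); last first.
  by field; rewrite !lt0r_neq0.
apply: (@le_trans _ _ (4 * omega_p ^+ 2 * (k * v) * (hbar * k ^+ 2 / (2 * M))^-1)).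
  rewrite ler_wpM2l//; first by rewrite !mulr_ge0 ?sqr_ge0// ltW.
  by rewrite lef_pV2 ?posrE// divr_gt0 ?mulr_gt0 ?exprn_gt0.
rewrite le_eqVlt; apply/orP; left; apply/eqP; field.
by rewrite !lt0r_neq0.
Unshelve. all: by end_near. Qed.

(** * Normalization and two-sided bounds on the outer integral *)

Lemma normalized_stoppingE v : 0 < v ->
  (((vF / (Zp * e * omega_p)) ^+ 2)%:E * stopping_power P v)%E =
  (((vF / v) ^+ 2 * (2 / (pi * omega_p ^+ 2)))%:E *
  \int[mu]_(k in `]0%R, +oo[) (k^-1 * inner_integral v k)%:E)%E.
Proof.
move=> v0; rewrite /stopping_power muleA -EFinM; congr (_%:E * _)%E.
have := pi_gt0 R; have := plasma_freq_gt0; move: (pi : R) omega_p => p w w0 p0.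
by field; rewrite !lt0r_neq0.
Qed.

Lemma outer_integrand_ge0 v k : 0 < v -> 0 < k -> 0 <= k^-1 * inner_integral v k.
Proof. by move=> v0 k0; rewrite mulr_ge0 ?inner_integral_ge0 ?invr_ge0 ?ltW. Qed.

Lemma outer_integral_ge : correlation_terms P ->
  exists2 A, 0 < A & \forall v \near +oo,
    (A%:E <= \int[mu]_(k in `]0%R, +oo[) (k^-1 * inner_integral v k)%:E)%E.
Proof.
move=> /inner_integral_ge[K K0 hK].
have wp2 : 0 < omega_p ^+ 2 by rewrite exprn_gt0// plasma_freq_gt0.
set A := pi / 4 * omega_p ^+ 2; have A0 : 0 < A by rewrite mulr_gt0// divr_gt0// pi_gt0.
(* 1 / (2K) bounds 1 / k from below on [K, 2K], an interval of length K. *)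
exists ((2 * K)^-1 * A * K); first by rewrite mulr_gt0// mulr_gt0// invr_gt0 mulr_gt0.
near=> v; have v0 : 0 < v by near: v; exact: nbhs_pinfty_gt.
apply: integral_outer_ge => //.
- apply: mulr_ge0; last exact: ltW.
  by rewrite invr_ge0 mulr_ge0// ltW.
- by move=> k; exact: outer_integrand_ge0.
- move=> k Kk k2K; have k0 : 0 < k := lt_le_trans K0 Kk.
  apply: ler_pM => //; first by rewrite invr_ge0 mulr_ge0// ltW.
  + exact: ltW.
  + by rewrite lef_pV2 ?posrE// mulr_gt0.
  + by move: k Kk k2K {k0}; near: v.
Unshelve. all: by end_near. Qed.

(** A bound O(v) on a length 2c/v, and O(v / k^2) beyond a cut-off of order v^2, contribute
    boundedly. In between, O(1 / k) from order 1/v to order v^2 gives the logarithm. *)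
Lemma outer_integral_le : bounded_static_response P ->
    fluctuation_dissipation P -> perfect_screening P -> holder_decay P ->
  exists2 A, 0 < A & \forall v \near +oo,
    (\int[mu]_(k in `]0%R, +oo[) (k^-1 * inner_integral v k)%:E <=
     (A * ln (v / vF))%:E)%E.
Proof.
move=> hB hC hD hE.
have [d d0 [T T0 hT]] := inner_integral_le_small_k hC hD.
have [A2 A20 hA2] := inner_integral_le_moderate_k hB.
have hA3 := inner_integral_le_large_k hE.
have wp0 := plasma_freq_gt0.
set D3 := 8 * M * omega_p ^+ 2 / hbar.
have D30 : 0 < D3 by rewrite divr_gt0 ?mulr_gt0 ?exprn_gt0.
(* The ratio of the two cut-offs is q (v / v_F)^3. *)
set q := kF * vF / (2 * c); have q0 : 0 < q by rewrite divr_gt0// ?mulr_gt0// invr_gt0.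
set D4 := D3 * vF ^+ 2 / kF.
have D40 : 0 < D4 by rewrite divr_gt0// mulr_gt0// exprn_gt0.
have cT0 : 0 < c * T by rewrite mulr_gt0.
have Aq0 : 0 <= A2 * `|ln q| by rewrite mulr_ge0// ltW.
(* The first three terms are bounded contributions, absorbed once ln (v / v_F) >= 1; 3 A2 comes from
   the cube in the ratio of the cut-offs. *)
exists (4 * (c * T) + A2 * `|ln q| + D4 + 3 * A2); first by lra.
near=> v.
have v1 : 1 <= v by near: v; exact: nbhs_pinfty_ge.
have v0 : 0 < v by lra.
have A2v : forall k, 2 * c / v <= k -> inner_integral v k <= A2 by near: v.
have A3v : forall k, kF * v ^+ 2 / vF ^+ 2 <= k ->
  inner_integral v k <= D3 * v * k^-1 by near: v.
set a := 2 * c / v; set cv := kF * v ^+ 2 / vF ^+ 2.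
have a0 : 0 < a by rewrite divr_gt0 ?mulr_gt0.
have ad : a < d.
  rewrite /a ltr_pdivrMr// -ltr_pdivrMl//; near: v.
  by apply: nbhs_pinfty_gt; exact: num_real.
have ha : hbar * a <= M * v.
  apply: (@le_trans _ _ (hbar * d)); first by rewrite (ler_wpM2l (ltW hbar0)) ?ltW.
  by rewrite -ler_pdivrMl//; near: v; exact: nbhs_pinfty_ge.
have cv_a : a < cv.
  apply: (lt_le_trans ad); apply: (@le_trans _ _ (kF / vF ^+ 2 * v)).
    rewrite -ler_pdivrMl ?divr_gt0 ?exprn_gt0//.
  rewrite /cv mulrAC (ler_wpM2r _)// ?invr_ge0 ?sqr_ge0//.
  by rewrite (ler_wpM2l (ltW kF0))// expr2 ler_peMr.
set t := ln (v / vF).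
have t1 : 1 <= t.
  rewrite -[leLHS](@expRK R) ler_ln ?posrE ?expR_gt0 ?divr_gt0//.
  by rewrite ler_pdivlMr//; near: v; exact: nbhs_pinfty_ge.
have lnE : ln cv - ln a = ln q + 3 * t.
  rewrite -ln_div ?posrE// ?(lt_trans a0)// /t.
  rewrite [3 * _]mulr_natl -lnXn ?divr_gt0// -lnM ?posrE//;
    last by rewrite exprn_gt0// divr_gt0.
  by congr ln; rewrite /cv /a /q; field; rewrite !lt0r_neq0.
have A10 : 0 <= 2 * v * T by rewrite !mulr_ge0// ltW.
have A30 : 0 <= D3 * v by rewrite mulr_ge0// ltW.
apply: (@le_trans _ _ (2 * v * T * a + A2 * (ln cv - ln a) + D3 * v * cv^-1)%:E).
  apply: integral_outer_le => //; first exact: ltW.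
  - by move=> k; exact: outer_integrand_ge0.
  - move=> k k0 ka; rewrite ler_pdivrMl//.
    apply: le_trans (hT v k v0 k0 (lt_trans ka ad)) _.
    rewrite [leRHS](_ : _ = 2 * (k * v) * T); last by ring.
    have hkv : hbar * k <= M * v.
      by apply: le_trans ha; rewrite (ler_wpM2l (ltW hbar0)) ?ltW.
    by have [_ ap] := alpha_bounds v0 k0 hkv; rewrite (ler_wpM2r (ltW T0)).
  - move=> k ak _; have k0 : 0 < k := lt_le_trans a0 ak.
    by rewrite mulrC ler_wpM2r ?A2v// invr_ge0 ltW.
  - move=> k ck; have k0 : 0 < k := lt_le_trans (lt_trans a0 cv_a) ck.
    rewrite [leRHS](_ : _ = k^-1 * (D3 * v * k^-1)); last by field; exact: lt0r_neq0.
    by rewrite ler_wpM2l ?A3v// invr_ge0 ltW.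
rewrite lee_fin lnE.
have -> : 2 * v * T * a = 4 * (c * T).
  by rewrite /a; set x := c; field; exact: lt0r_neq0.
have e3 : D3 * v * cv^-1 <= D4.
  rewrite [leLHS](_ : _ = D4 / v); last by rewrite /cv /D4; field; rewrite !lt0r_neq0.
  by rewrite ler_pdivrMr// ler_peMr// ltW.
have e2 : A2 * (ln q + 3 * t) <= A2 * `|ln q| + 3 * A2 * t.
  by rewrite mulrDr mulrCA mulrA lerD2r (ler_wpM2l (ltW A20)) ?ler_norm.
have e4 : 4 * (c * T) + A2 * `|ln q| + D4 <= (4 * (c * T) + A2 * `|ln q| + D4) * t.
  by rewrite ler_peMr//; lra.
rewrite [leRHS]mulrDl; apply: le_trans (lerD e4 (lexx _)).
rewrite [leRHS](_ : _ = 4 * (c * T) + (A2 * `|ln q| + 3 * A2 * t) + D4); last by ring.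
by rewrite lerD// lerD2l.
Unshelve. all: by end_near. Qed.

End stopping.

Theorem theorem1 (R : realType) (P : plasma_projectile R)
    (hconst : admissible_constants P)
    (hA_sum_rules : sum_rules P)
    (hA_correlations : correlation_terms P)
    (hA_static : bounded_static_response P)
    (hB : collective_mode P)
    (hC : fluctuation_dissipation P)
    (hD : perfect_screening P)
    (hE : holder_decay P) :
  let normalized_stopping v :=
    (((fermi_velocity P
         / (charge_number P * elementary_charge P * plasma_freq P)) ^+ 2)%:E
     * stopping_power P v)%E in
  asym_le (fun v => ((fermi_velocity P / v) ^+ 2)%:E) normalized_stopping /\
  asym_le normalized_stopping
    (fun v => ((fermi_velocity P / v) ^+ 2 * ln (v / fermi_velocity P))%:E).

Proof.
have [[[Zp0 e0 m0 mM] [n0 h0 beta0] [vF0 kF0] _]] := hconst.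
have wp0 := plasma_freq_gt0 hconst.
have G0 : 0 < 2 / (pi * plasma_freq P ^+ 2).
  by rewrite divr_gt0 ?mulr_gt0 ?pi_gt0 ?exprn_gt0.
set G := 2 / _ in G0.
move=> f; split.
  have [A A0 hA] := outer_integral_ge hconst hA_sum_rules hA_correlations.
  (* The normalized stopping power is (v_F / v)^2 G times the outer integral, which is at least
     A. *)
  exists (G * A)^-1; first by rewrite invr_gt0 mulr_gt0.
  near=> v; have v0 : 0 < v by near: v; exact: nbhs_pinfty_gt.
  rewrite /f normalized_stoppingE// -/G muleA -EFinM.
  have -> : (G * A)^-1 * ((fermi_velocity P / v) ^+ 2 * G) =
      (fermi_velocity P / v) ^+ 2 / A.
    by field; rewrite !lt0r_neq0.
  have x0 : 0 <= (fermi_velocity P / v) ^+ 2 / A by rewrite divr_ge0 ?sqr_ge0 ?ltW.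
  apply: (@le_trans _ _ (((fermi_velocity P / v) ^+ 2 / A)%:E * A%:E)%E).
    by rewrite -EFinM divfK// gt_eqF.
  by apply: lee_wpmul2l; [rewrite lee_fin|near: v].
have [A A0 hA] := outer_integral_le hconst hA_sum_rules hA_static hC hD hE.
exists (G * A); first by rewrite mulr_gt0.
near=> v; have v0 : 0 < v by near: v; exact: nbhs_pinfty_gt.
rewrite /f normalized_stoppingE// -/G.
rewrite [leRHS](_ : _ = ((fermi_velocity P / v) ^+ 2 * G)%:E *
  (A * ln (v / fermi_velocity P))%:E)%E; last first.
  by rewrite -!EFinM; congr EFin; ring.
apply: lee_wpmul2l; last by near: v.
by rewrite lee_fin mulr_ge0 ?sqr_ge0// ltW.
Unshelve. all: by end_near. Qed.
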